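(* Let $n\geq 2$ and $d\geq 1$ be integers. There is a constant $c=c(n,d)$, depending only on $n$ and $d$, such that for every absolutely irreducible form $F(\mathbf{x})\in\mathbb{Z}[x_1,\ldots,x_n]$ of degree $d$ and every real $B\geq 1$, $$N(F;B)\leq c\,B^{n-1}.$$ The same statement remains true if $F$ is allowed to have coefficients in $\overline{\mathbb{Q}}$.
   Context: $Z_n$ denotes the set of all $\mathbf{x}=(x_1,\ldots,x_n)\in\mathbb{Z}^n$, not all $x_i$ zero, with $\gcd(x_1,\ldots,x_n)=1$ and such that $x_i>0$ for the smallest index $i$ with $x_i\neq 0$. For a form $F$ in $n$ variables and $B\geq 1$, $$N(F;B)=\#\{\mathbf{x}\in Z_n:\ F(\mathbf{x})=0,\ \max_{1\leq i\leq n}|x_i|\leq B\}.$$ ''Absolutely irreducible'' means irreducible over $\overline{\mathbb{Q}}$. *)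

(* Defs.v *)
From HB Require Import structures.
From mathcomp Require Import all_boot all_order all_algebra all_field.
From mathcomp Require Import finmap boolp classical_sets functions cardinality.
From mathcomp Require Import reals mpoly.

Set Implicit Arguments.
Unset Strict Implicit.
Unset Printing Implicit Defensive.

Import Order.TTheory GRing.Theory Num.Theory.

Local Open Scope classical_set_scope.
Local Open Scope ring_scope.

Definition irreducible (A : idomainType) (p : A) : Prop :=
  [/\ p != 0, p \isn't a GRing.unit
    & forall q r : A, p = q * r -> q \is a GRing.unit \/ r \is a GRing.unit].

(* [algC] is the algebraic closure of the rationals. *)
Definition absolutely_irreducible (n : nat) (F : {mpoly algC[n]}) : Prop :=
  irreducible F.

Definition primitive_points (n : nat) : set 'rV[int]_n :=
  [set x : 'rV[int]_n | [/\ x != 0,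
               \big[gcdn/0%N]_(i < n) `|x ord0 i|%N = 1%N
             & forall i : 'I_n, x ord0 i != 0 ->
                 (forall j : 'I_n, (j < i)%N -> x ord0 j = 0) ->
                 0 < x ord0 i]].

Definition zero_points (R : realType) (K : comNzRingType) (n : nat)
    (F : {mpoly K[n]}) (B : R) : set 'rV[int]_n :=
  [set x : 'rV[int]_n | [/\ primitive_points x,
               F.@[fun i : 'I_n => (x ord0 i)%:~R] = 0
             & ((\max_(i < n) `|x ord0 i|)%N)%:R <= B]].

(* [fset_set] sends infinite sets to the empty set; this value never occurs
   here, by [finite_zero_points] below. *)
Definition count_zeros (R : realType) (K : comNzRingType) (n : nat)
    (F : {mpoly K[n]}) (B : R) : nat :=
  #|` fset_set (zero_points F B)|.

Lemma finite_zero_points (R : realType) (K : comNzRingType) (n : nat)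
  (F : {mpoly K[n]}) (B : R) : finite_set (zero_points F B).
Proof.
pose m := Num.truncn B.
pose f (g : {ffun 'I_n -> 'I_(m + m).+1}) : 'rV[int]_n :=
  \row_i ((g i : nat)%:Z - m%:Z).
apply: (@sub_finite_set _ _ (f @` setT)); last exact: finite_image.
move=> x [_ _ xB].
have xm (i : 'I_n) : (`|x ord0 i|%N <= m)%N.
  apply: leq_trans (leq_bigmax (F := fun k : 'I_n => absz (x ord0 k)) i) _.
  by rewrite /m truncn_ge_nat // (le_trans _ xB).
exists [ffun i => inord (absz (x ord0 i + m%:Z))] => //.
apply/rowP => i; rewrite mxE ffunE.
have xi : - m%:Z <= x ord0 i <= m%:Z.
  by rewrite -ler_norml -abszE lez_nat; exact: xm.
have [lo hi] := andP xi.
have ge0 : 0 <= x ord0 i + m%:Z by rewrite -lerBlDr sub0r.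
rewrite inordK ?gez0_abs ?addrK //.
by rewrite ltnS -lez_nat gez0_abs // PoszD lerD2r.
Qed.

(* Main.v *)
(** An irreducible form is nonzero, and a nonzero polynomial [p] of degree at most
    [d] in each of [n] variables has at most [n * d * k ^ (n - 1)] zeros in a box
    of side [k], by induction on [n]: pick a nonzero coefficient [c] of [p] seen
    as a polynomial in the last variable. Over each zero of [c] there are at most
    [k] zeros of [p], and over each other point at most [d]. The points counted
    lie in a box of side at most [3 * B]. *)
Require Import Defs.
From mathcomp Require Import all_boot all_order all_algebra all_field.
From mathcomp Require Import finmap classical_sets cardinality.
From mathcomp Require Import reals mpoly zify lra.

Import Order.TTheory GRing.Theory Num.Theory.

Local Open Scope ring_scope.

Lemma lift_ord_max_widen n (k : 'I_n) :
  lift ord_max k = widen_ord (leqnSn n) k.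
Proof. by apply: val_inj; exact: lift_max. Qed.

(** The exponent [j] goes at the end because [muni] singles out the variable of index [ord_max]. *)
Definition mnmrcons n (m : 'X_{1..n}) (j : nat) : 'X_{1..n.+1} :=
  [multinom of rcons m j].

Lemma mnmrcons_max n (m : 'X_{1..n}) j : mnmrcons n m j ord_max = j.
Proof. by rewrite multinomE (tnth_nth 0%N) nth_rcons size_tuple ltnn eqxx. Qed.

Lemma mnmrcons_widen n (m : 'X_{1..n}) j (i : 'I_n) :
  mnmrcons n m j (widen_ord (leqnSn n) i) = m i.
Proof.
by rewrite multinomE !mnm_tnth !(tnth_nth 0%N) nth_rcons size_tuple /= ltn_ord.
Qed.

Lemma mnmrcons_eq n (m : 'X_{1..n.+1}) (m' : 'X_{1..n}) j :
  (m == mnmrcons n m' j) =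
  ([multinom m (widen_ord (leqnSn n) i) | i < n] == m') && (m ord_max == j).
Proof.
apply/eqP/andP => [->|[/eqP <- /eqP <-]].
  rewrite mnmrcons_max eqxx; split=> //; apply/eqP/mnmP => i.
  by rewrite mnmE mnmrcons_widen.
apply/mnmP => i; case: (unliftP ord_max i) => [k|] ->; last first.
  by rewrite mnmrcons_max.
by rewrite lift_ord_max_widen mnmrcons_widen mnmE.
Qed.

Lemma coef_muni (K : nzRingType) n (p : {mpoly K[n.+1]}) j m :
  ((muni p)`_j)@_m = p@_(mnmrcons n m j).
Proof.
rewrite muniE coef_sum raddf_sum [in RHS](mpolyE p) raddf_sum /=.
apply: eq_bigr => m' _; rewrite coefZ coefXn mcoeffZ mcoeffX mnmrcons_eq.
rewrite eq_sym; case: (_ == j).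
  by rewrite mulr1 mcoeffZ mcoeffX andbT.
by rewrite !mulr0 mcoeff0 andbF mulr0.
Qed.

(** This turns the zeros of [p] over a fixed choice of the first [n] coordinates into roots of a
    univariate polynomial. *)
Lemma horner_muni (K : comNzRingType) n (p : {mpoly K[n.+1]})
    (v : 'I_n.+1 -> K) :
  (map_poly (meval (fun i => v (widen_ord (leqnSn n) i))) (muni p)).[v ord_max]
  = p.@[v].
Proof.
rewrite muniE raddf_sum horner_sum mevalE; apply: eq_bigr => m _ /=.
rewrite map_polyZ map_polyXn hornerZ hornerXn /= mevalZ mevalX -mulrA.
rewrite big_ord_recr /=; congr (_ * (_ * _)); apply: eq_bigr => i _.
by rewrite mnmE.
Qed.

Lemma card_roots_le (K : idomainType) (T : finType) (a : T -> K) (q : {poly K}) :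
  injective a -> q != 0 -> (#|[set x | root q (a x)]| < size q)%N.
Proof.
move=> ainj q0; rewrite cardE -(size_map a); apply: max_poly_roots => //.
  by apply/allP => _ /mapP[x + ->]; rewrite mem_enum inE.
by rewrite map_inj_uniq ?enum_uniq.
Qed.

(* The factor [#|T|] on the left avoids the exponent [n - 1], truncated at n = 0. *)
Lemma card_mpoly_zeros (K : idomainType) n d (p : {mpoly K[n]})
    (T : finType) (a : T -> K) :
  injective a -> p != 0 -> (forall m i, m \in msupp p -> m i <= d)%N ->
  (#|[set g : {ffun 'I_n -> T} | p.@[fun i => a (g i)] == 0%R]| * #|T|
     <= n * d * #|T| ^ n)%N.
Proof.
move=> ainj; elim: n p => [|n IHn] p p0 pd.
  (* Without variables, the value of [p] is its only coefficient, which is nonzero, so there are no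
     zeros. *)
  rewrite leqn0 muln_eq0 cards_eq0; apply/orP; left; apply/eqP/setP => g.
  rewrite !inE; apply: contraNF p0.
  rewrite mevalE [in X in _ -> X](mpolyE p) => /eqP s0; apply/eqP.
  apply/mpolyP => m; rewrite -(mpolyE p) mcoeff0 -s0 [in LHS](mpolyE p).
  rewrite raddf_sum /=; apply: eq_bigr => m' _; rewrite big_ord0.
  by rewrite mcoeffZ mcoeffX (_ : m' = m) ?eqxx //; apply/mnmP; case.
have q0 : muni p != 0.
  apply: contraNneq p0 => q0; apply/eqP/mpolyP => m.
  rewrite (_ : m = mnmrcons n [multinom m (widen_ord (leqnSn n) i) | i < n]
     (m ord_max)); last by apply/eqP; rewrite mnmrcons_eq !eqxx.
  by rewrite -coef_muni q0 coef0 !mcoeff0.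
(* The nonzero coefficient chosen for the induction is the leading one. *)
set j := (size (muni p)).-1.
have pj0 : (muni p)`_j != 0 by rewrite -lead_coefE lead_coef_eq0.
have size_muni : (size (muni p) <= d.+1)%N.
  apply/leq_sizeP => k dk; apply/mpolyP => m; rewrite coef_muni mcoeff0.
  apply: memN_msupp_eq0; apply/negP => /(pd _ ord_max).
  by rewrite mnmrcons_max leqNgt dk.
have {}IHn := IHn _ pj0 _.
set Z' := [set g | _] in IHn.
have {}IHn : (#|Z'| * #|T| <= n * d * #|T| ^ n)%N.
  apply: IHn => m i; rewrite mcoeff_msupp coef_muni -mcoeff_msupp.
  by move=> /(pd _ (widen_ord (leqnSn n) i)); rewrite mnmrcons_widen.
set Z := [set g | _].
pose q (g : {ffun 'I_n -> T}) := map_poly (meval (fun i => a (g i))) (muni p).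
pose W (g : {ffun 'I_n -> T}) := [set x | root (q g) (a x)].
(* Splitting off the last coordinate embeds [Z] in the disjoint union of the fibres [W g]. *)
pose restr (g : {ffun 'I_n.+1 -> T}) :=
  ([ffun i => g (widen_ord (leqnSn n) i)], g ord_max).
have restr_inj : injective restr.
  move=> g h [/ffunP gh ghm]; apply/ffunP => i.
  case: (unliftP ord_max i) => [k|] -> //.
  by rewrite lift_ord_max_widen; have := gh k; rewrite !ffunE.
have ZW : (#|Z| <= \sum_g #|W g|)%N.
  rewrite -(card_imset _ restr_inj).
  rewrite (eq_bigr (fun g => \sum_(x in W g) 1)%N); last first.
    by move=> g _; rewrite sum1_card.
  rewrite pair_big_dep sum1_card; apply/subset_leq_card/fintype.subsetP.
  move=> _ /imsetP[g + ->]; rewrite inE -horner_muni => /eqP pg.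
  suff : g ord_max \in W (restr g).1 by [].
  rewrite inE; apply/eqP; rewrite -[RHS]pg; congr (_.[_]).
  by apply: eq_map_poly => r; apply: meval_eq => i; rewrite ffunE.
have Wle g : (#|W g| <= (g \in Z') * #|T| + d)%N.
  case: (boolP (g \in Z')) => [_|]; rewrite ?mul1n ?mul0n.
    by apply: leq_trans (leq_addr _ _); exact: max_card.
  (* Off [Z'] the coefficient of index [j] survives evaluation, so [q g] is a nonzero polynomial of
     degree at most [d]. *)
  rewrite inE => gj; rewrite -ltnS; apply: leq_trans size_muni.
  have qg0 : q g != 0.
    apply: contraNneq gj => /(congr1 (fun r : {poly K} => r`_j)).
    by rewrite coef_map coef0 => /eqP.
  by apply: leq_trans (card_roots_le _ _ _ _ ainj qg0) _; exact: size_poly.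
have sumle : (\sum_g #|W g| <= #|Z'| * #|T| + #|T| ^ n * d)%N.
  apply: leq_trans (leq_sum _ (fun g _ => Wle g)) _.
  rewrite big_split /= -big_distrl /= sum_nat_const card_ffun card_ord.
  by rewrite -(sum1_card (mem Z')) [X in (_ <= X * _ + _)%N]big_mkcond.
(* By induction the sum is at most [n * d * #|T| ^ n + d * #|T| ^ n]; multiplying by [#|T|] gives
   the bound for [n.+1]. *)
apply: leq_trans (leq_mul (leq_trans ZW sumle) (leqnn _)) _.
rewrite mulnDl expnS mulSn mulnDl addnC leq_add //; nia.
Qed.

(** A general [K] serves both [int] and [algC]; in a [numDomainType] distinct integers stay
    distinct, so the box embeds in [K]. *)
Lemma count_zeros_le (R : realType) (K : numDomainType) n d (F : {mpoly K[n]})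
    (B : R) :
  (0 < n)%N -> F != 0 -> F \is d.-homog -> 1 <= B ->
  (count_zeros F B)%:R <= (n * d * 3 ^ (n - 1))%:R * B ^+ (n - 1).
Proof.
move=> n0 F0 Fd B1; pose m := Num.truncn B.
(* The ordinals, shifted by [m], run over the integers from [-m] to [m]. *)
pose a (t : 'I_(m + m).+1) : K := ((t : nat)%:Z - m%:Z)%:~R.
have ainj : injective a.
  by move=> s t /intr_inj /addIr [] /val_inj.
have Fdeg mu i : mu \in msupp F -> (mu i <= d)%N.
  by move=> /(dhomog_mf Fd) <-; rewrite /= mdegE (bigD1 i) //= leq_addr.
have := card_mpoly_zeros K n d F _ a ainj F0 Fdeg.
set Z := [set g | _]; rewrite card_ord => Zle.
have cZ : (count_zeros F B <= #|Z|)%N.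
  pose f (g : {ffun 'I_n -> 'I_(m + m).+1}) : 'rV[int]_n :=
    \row_i ((g i : nat)%:Z - m%:Z).
  rewrite /count_zeros -(size_image f (mem Z)).
  apply: uniq_leq_size; first exact: fset_uniq.
  move=> x; rewrite in_fset_set; last exact: finite_zero_points.
  rewrite inE => -[_ Fx xB].
  have xm (i : 'I_n) : (`|x ord0 i|%N <= m)%N.
    apply: leq_trans (leq_bigmax (F := fun k : 'I_n => absz (x ord0 k)) i) _.
    by rewrite truncn_ge_nat // (le_trans ler01 B1).
  have fx : x = f [ffun i => inord (absz (x ord0 i + m%:Z))].
    apply/rowP => i; move: (xm i); rewrite mxE ffunE -[ord0]/(0 : 'I_1).
    by move: (x 0 i) => t tm; rewrite inordK; lia.
  apply/mapP; exists [ffun i => inord (absz (x ord0 i + m%:Z))] => //.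
  rewrite mem_enum inE -Fx; apply/eqP/meval_eq => i.
  by rewrite {2}fx mxE.
(* One factor, the side of the box, cancels; the exponent [n - 1] is not truncated since [n] is
   positive. *)
have {}Zle : (#|Z| <= n * d * (m + m).+1 ^ (n - 1))%N.
  rewrite -(leq_pmul2r (ltn0Sn (m + m))); apply: leq_trans Zle _.
  by rewrite -[in leqRHS]mulnA -expnSr subn1 prednK.
(* The constant 3 arises here: [m <= B] and [1 <= B] give [2 * m + 1 <= 3 * B]. *)
have mB : (m + m).+1%:R <= 3 * B.
  have mB : m%:R <= B by rewrite /m truncn_le // (le_trans ler01).
  by rewrite -addn1 !natrD; lra.
apply: (@le_trans _ _ (n * d * (m + m).+1 ^ (n - 1))%:R).
  by rewrite ler_nat (leq_trans cZ).
rewrite natrM [X in _ <= X * _]natrM -mulrA ler_wpM2l // !natrX -exprMn.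
by rewrite lerXn2r // nnegrE ?mulr_ge0 ?ler0n // (le_trans ler01 B1).
Qed.

Theorem theorem1 (R : realType) (n d : nat) (hn : (2 <= n)%N) (hd : (1 <= d)%N) :
  (exists c : R, forall F : {mpoly int[n]},
     F \is d.-homog ->
     absolutely_irreducible (map_mpoly (intr : int -> algC) F) ->
     forall B : R, 1 <= B -> (count_zeros F B)%:R <= c * B ^+ (n - 1)%N) /\
  (exists c : R, forall F : {mpoly algC[n]},
     F \is d.-homog ->
     absolutely_irreducible F ->
     forall B : R, 1 <= B -> (count_zeros F B)%:R <= c * B ^+ (n - 1)%N).
Proof.
split; exists (n * d * 3 ^ (n - 1))%:R => F Fd [F0 _ _] B B1.
  apply: count_zeros_le (ltnW hn) _ Fd B1.
  (* Irreducibility is given for the image of [F] over [algC]; a zero [F] would have zero image. *)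
  by apply: contraNneq F0 => ->; rewrite raddf0.
exact: count_zeros_le (ltnW hn) F0 Fd B1.
Qed.
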